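(* Every infinite polycyclic group belonging to the class $\mathcal S$ is nilpotent.
   Context: $\mathcal S$ denotes the class of all groups $G$ such that every non-nilpotent subgroup $H \le G$ satisfies $N_G(H) = H$. *)

(* Defs.v *)
From mathcomp Require Import all_boot all_order all_algebra.
From mathcomp Require Import boolp classical_sets functions cardinality.

Set Implicit Arguments.
Unset Strict Implicit.
Unset Printing Implicit Defensive.

Local Open Scope classical_set_scope.
Local Open Scope group_scope.

(* The groups here may be infinite, so subgroups are classical sets over a    *)
(* [groupType] rather than finite sets over a [finGroupType].                 *)

Definition is_subgroup (G : groupType) (H : set G) : Prop :=
  group_closed [in H].

Definition normalizer (G : groupType) (H : set G) : set G :=
  [set x | [set h ^ x | h in H] = H].

Definition is_normal (G : groupType) (N K : set G) : Prop :=
  [/\ is_subgroup N, is_subgroup K, N `<=` K & K `<=` normalizer N].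

Definition commutator_subgroup (G : groupType) (A B : set G) : set G :=
  smallest (@is_subgroup G) [set z | exists x y, [/\ A x, B y & z = [~ x, y]]].

Fixpoint lower_central (G : groupType) (H : set G) (n : nat) : set G :=
  if n is m.+1 then commutator_subgroup (lower_central H m) H else H.

Definition is_nilpotent (G : groupType) (H : set G) : Prop :=
  exists n, lower_central H n = [set 1].

Definition expgz (G : groupType) (x : G) (k : int) : G :=
  match k with Posz n => x ^+ n | Negz n => x ^- n.+1 end.

Definition left_coset (G : groupType) (x : G) (N : set G) : set G :=
  [set x * u | u in N].

(* K / N is cyclic: every coset of N in K is a power of a single coset x N,   *)
(* where (x N)^k = x^k N since N is normal in K.                              *)
Definition cyclic_quotient (G : groupType) (K N : set G) : Prop :=
  exists2 x, K x &
    forall y, K y -> exists k : int, left_coset y N = left_coset (expgz x k) N.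

Definition polycyclic (G : groupType) : Prop :=
  exists (n : nat) (A : nat -> set G),
    [/\ A 0%N = [set 1], A n = [set: G] &
        forall i, (i < n)%N ->
          is_normal (A i) (A i.+1) /\ cyclic_quotient (A i.+1) (A i)].

Definition class_S (G : groupType) : Prop :=
  forall H : set G, is_subgroup H -> ~ is_nilpotent H -> normalizer H = H.

Lemma is_subgroupP (G : groupType) (H : set G) :
  is_subgroup H <->
  [/\ H 1, forall x y, H x -> H y -> H (x * y) & forall x, H x -> H x^-1].
Proof.
split=> [gH | [H1 HM HV]].
  split; first exact: set_mem (fst gH).
    by move=> x y Hx Hy; apply: set_mem; apply: (group_closedM gH); apply: mem_set.
  by move=> x Hx; apply: set_mem; apply: (group_closedV gH); apply: mem_set.
split=> [|x y /set_mem Hx /set_mem Hy]; apply: mem_set; first exact: H1.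
by apply: HM => //; apply: HV.
Qed.

(* Main.v *)
From HB Require Import structures.
Require Import Defs.
From mathcomp Require Import all_boot all_order all_algebra.
From mathcomp Require Import boolp classical_sets functions cardinality.
From mathcomp Require Import zify.

(* Suppose G is not nilpotent. Proper normal subgroups are nilpotent, so by
   Fitting's theorem and the maximal condition there is a largest one M. Every
   proper normal K with G / K abelian then satisfies G = <x> K for each x
   outside M, with a positive power of x in K: otherwise G would be the product
   of the proper subgroups <x^2> K and <x^3> K. So G / K is finite, and some x
   outside M has a power of prime exponent p in M.
     Let N be maximal among the normal subgroups with G / N not periodic; such N
   exist because an infinite polycyclic group is not periodic. The preimage A of
   the centre of M / N has periodic quotient G / A, and A / N is torsion-free.
   Let f be the action of x on A / N; then f^p = 1. Put d = f - 1 and let H be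
   <x> A_1, where A_1 / N = d (A / N); A normalises H. If H is nilpotent, then d
   is nilpotent, and f^p = 1 forces d = 0 on a torsion-free module. Otherwise
   A <= H, hence d (A / N) = d^2 (A / N); as f^p = 1 makes d^p divisible by p,
   d (A / N) is p-divisible and vanishes by the maximal condition. Thus A / N
   is central in G / N.
     Finally, if g in M is central modulo A, then [g, h]^k lies in N as soon as
   g^k lies in A, and A / N is torsion-free; so g is in A, hence M <= A, and G / N
   is abelian. It is then finite by the first step with K = N, a contradiction. *)

Set Implicit Arguments.
Unset Strict Implicit.
Unset Printing Implicit Defensive.

Import Order.TTheory GRing.Theory.
Local Open Scope ring_scope.
Local Open Scope classical_set_scope.
Local Open Scope group_scope.

Ltac group_id := by rewrite /commg /conjg !gnorm.

(** * Subgroups, integer powers and normality in a possibly infinite group *)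

Section Subgroups.
Variable G : groupType.
Implicit Types (x y g : G) (A B H K L M N P : set G) (k l : int).

Lemma subgroup1 H : is_subgroup H -> H 1.
Proof. by case/is_subgroupP. Qed.

Lemma subgroupM H x y : is_subgroup H -> H x -> H y -> H (x * y).
Proof. by case/is_subgroupP=> _ HM _; apply: HM. Qed.

Lemma subgroupV H x : is_subgroup H -> H x -> H x^-1.
Proof. by case/is_subgroupP=> _ _; apply. Qed.

Lemma subgroupX H x n : is_subgroup H -> H x -> H (x ^+ n).
Proof.
move=> sH Hx; elim: n => [|n IH]; first exact: subgroup1.
by rewrite expgS; apply: subgroupM.
Qed.

Lemma subgroup_expgz H x k : is_subgroup H -> H x -> H (expgz x k).
Proof.
move=> sH Hx; case: k => n /=; first exact: subgroupX.
by apply: subgroupV => //; apply: subgroupX.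
Qed.

Lemma subgroupMl H x y : is_subgroup H -> H x -> H (x * y) -> H y.
Proof.
by move=> sH Hx Hxy; rewrite -(mulKg x y); apply: subgroupM => //; apply: subgroupV.
Qed.

Lemma subgroupMr H x y : is_subgroup H -> H y -> H (x * y) -> H x.
Proof.
by move=> sH Hy Hxy; rewrite -(mulgK y x); apply: subgroupM => //; apply: subgroupV.
Qed.

Lemma subgroupJ H x y : is_subgroup H -> H x -> H y -> H (x ^ y).
Proof.
move=> sH Hx Hy; rewrite /conjg.
by do !apply: subgroupM => //; apply: subgroupV.
Qed.

Lemma subgroupR H x y : is_subgroup H -> H x -> H y -> H [~ x, y].
Proof.
move=> sH Hx Hy; rewrite /commg.
by apply: subgroupM => //; [apply: subgroupV|apply: subgroupJ].
Qed.

Lemma subgroupT : is_subgroup [set: G].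
Proof. exact/is_subgroupP. Qed.

Lemma subgroup_set1 : is_subgroup [set (1 : G)].
Proof.
apply/is_subgroupP; split=> //= [x y -> ->|x ->]; first by rewrite mulg1.
by rewrite invg1.
Qed.

Lemma subgroupI H K : is_subgroup H -> is_subgroup K -> is_subgroup (H `&` K).
Proof.
move=> sH sK; apply/is_subgroupP; split.
- by split; apply: subgroup1.
- by move=> x y [? ?] [? ?]; split; apply: subgroupM.
- by move=> x [? ?]; split; apply: subgroupV.
Qed.

Lemma subgroup_preimJ H g : is_subgroup H -> is_subgroup [set y | H (y ^ g)].
Proof.
move=> sH; apply/is_subgroupP; split=> /=.
- by rewrite conj1g; apply: subgroup1.
- by move=> x y Hx Hy; rewrite conjMg; apply: subgroupM.
- by move=> x Hx; rewrite conjVg; apply: subgroupV.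
Qed.

Lemma smallest_subgroup A : is_subgroup (smallest (@is_subgroup G) A).
Proof.
apply/is_subgroupP; split.
- by move=> H [sH _]; apply: subgroup1.
- by move=> x y Hx Hy H [sH AH]; apply: subgroupM => //; [apply: Hx|apply: Hy].
- by move=> x Hx H [sH AH]; apply: subgroupV => //; apply: Hx.
Qed.

Lemma normalizer_intro H g : is_subgroup H ->
  (forall y, H y -> H (y ^ g)) -> (forall y, H y -> H (y ^ g^-1)) ->
  normalizer H g.
Proof.
move=> sH Hg HgV; rewrite /normalizer /=; apply/seteqP; split.
  by move=> _ [y Hy <-]; apply: Hg.
by move=> y Hy; exists (y ^ g^-1); [apply: HgV|rewrite conjgKV].
Qed.

Lemma normalizerP H g y : normalizer H g -> H y -> H (y ^ g).
Proof.
move=> nHg Hy; have <- : [set h ^ g | h in H] = H by [].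
by exists y.
Qed.

Lemma expgz1 x : expgz x 1%:Z = x.
Proof. by []. Qed.

Lemma expgzS x k : expgz x (k + 1)%R = expgz x k * x.
Proof.
case: k => n; first by rewrite -PoszD addn1 /= expgSr.
case: n => [|n]; first by rewrite /= mulVg.
have -> : (Negz n.+1 + 1)%R = Negz n by lia.
by rewrite /= [x ^+ n.+2]expgS invgM mulgVK.
Qed.

Lemma expgzD x k l : expgz x (k + l)%R = expgz x k * expgz x l.
Proof.
elim: l => [|n IH|n IH]; first by rewrite addr0 mulg1.
  by rewrite -addn1 PoszD addrA !expgzS IH mulgA.
apply: (@mulIg _ x); rewrite -mulgA -!expgzS.
have -> : (- n.+1%:Z + 1)%R = (- n%:Z)%R by lia.
by rewrite -IH; congr expgz; lia.
Qed.

Lemma expgzN x k : expgz x (- k)%R = (expgz x k)^-1.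
Proof. by apply/esym/mulg1_eq; rewrite -expgzD subrr. Qed.

Lemma expgzM x k l : expgz x (k * l)%R = expgz (expgz x k) l.
Proof.
elim: l => [|n IH|n IH]; first by rewrite mulr0.
  by rewrite -addn1 PoszD expgzS mulrDr mulr1 expgzD IH.
apply: (@mulIg _ (expgz x k)); rewrite -expgzS -expgzD.
have -> : (- n.+1%:Z + 1)%R = (- n%:Z)%R by lia.
by rewrite -IH; congr expgz; lia.
Qed.

Definition normal_subgroup N := is_subgroup N /\ forall x g, N x -> N (x ^ g).

Lemma normal_normalizer N g : normal_subgroup N -> normalizer N g.
Proof. by case=> sN nN; apply: normalizer_intro => // y; apply: nN. Qed.

Lemma normalJ N x g : normal_subgroup N -> N x -> N (x ^ g).
Proof. by case=> _; apply. Qed.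

Lemma commg_sym N x y : is_subgroup N -> N [~ x, y] -> N [~ y, x].
Proof. by move=> sN Nxy; rewrite -invgR; apply: subgroupV. Qed.

Lemma normalRl N x y : normal_subgroup N -> N x -> N [~ x, y].
Proof.
move=> nN Nx; have sN := nN.1; rewrite commgEl.
by apply: subgroupM; [|apply: subgroupV|apply: normalJ].
Qed.

Lemma normalRr N x y : normal_subgroup N -> N y -> N [~ x, y].
Proof. by move=> nN Ny; apply: commg_sym; [case: nN|apply: normalRl]. Qed.

(** This is the preimage of the centraliser of the image of [S] in G / N; as it is a subgroup,
    centrality modulo [N] can be checked on generators. *)
Lemma subgroup_relcent N (S : set G) : normal_subgroup N ->
  is_subgroup [set y | forall g, S g -> N [~ y, g]].
Proof.
move=> nN; have sN := nN.1; apply/is_subgroupP; split=> /=.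
- by move=> g _; rewrite comm1g; apply: subgroup1.
- move=> x y Nx Ny g Sg.
  have -> : [~ x * y, g] = [~ x, g] ^ y * [~ y, g] by group_id.
  by apply: subgroupM => //; [apply: normalJ => //; apply: Nx|apply: Ny].
- move=> x Nx g Sg.
  have -> : [~ x^-1, g] = ([~ x, g]^-1) ^ x^-1 by group_id.
  by apply: normalJ => //; apply: subgroupV => //; apply: Nx.
Qed.

Lemma subgroup_relcent1 N x : normal_subgroup N ->
  is_subgroup [set g | N [~ x, g]].
Proof.
move=> nN; have := @subgroup_relcent N [set x] nN.
have sN := nN.1.
congr is_subgroup; apply/seteqP; split=> g /=.
  by move=> /(_ x erefl); apply: commg_sym.
by move=> Nxg y ->; apply: commg_sym.
Qed.

(** The product <x> B, a subgroup as soon as [x] normalises [B]. *)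
Definition cycle_mul x B : set G :=
  [set y | exists k, exists2 b, B b & y = expgz x k * b].

Lemma normalizer_subgroup H : is_subgroup (normalizer H).
Proof.
have nE g : normalizer H g <-> (forall y, H (y ^ g) <-> H y).
  split=> [nH y|nH].
    by rewrite -[in X in X <-> _]nH; split=> [[z Hz /conjg_inj<-]//|Hy]; exists y.
  apply/seteqP; split=> [_ [y Hy <-]|y Hy]; first exact/nH.
  by exists (y ^ g^-1); rewrite ?conjgKV//; apply/nH; rewrite conjgKV.
apply/is_subgroupP; split.
- by apply/nE=> y; rewrite conjg1.
- by move=> x y /nE Hx /nE Hy; apply/nE=> z; rewrite conjgM Hy Hx.
- by move=> x /nE Hx; apply/nE=> z; rewrite -Hx conjgKV.
Qed.

Lemma cycle_mul_subgroup x B : is_subgroup B -> normalizer B x ->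
  is_subgroup (cycle_mul x B).
Proof.
move=> sB nBx.
have nBz k b : B b -> B (b ^ expgz x k).
  by apply: normalizerP; apply: subgroup_expgz => //; apply: normalizer_subgroup.
apply/is_subgroupP; split.
- by exists 0%R, 1; [apply: subgroup1|rewrite mulg1].
- move=> _ _ [k [b Bb ->]] [l [c Bc ->]].
  exists (k + l)%R, (b ^ expgz x l * c).
    by apply: subgroupM => //; apply: nBz.
  by rewrite expgzD; group_id.
- move=> _ [k [b Bb ->]]; exists (- k)%R, ((b^-1) ^ expgz x (- k)%R).
    by apply: nBz; apply: subgroupV.
  by rewrite expgzN; group_id.
Qed.

Lemma cycle_mul_id x B : is_subgroup B -> cycle_mul x B x.
Proof. by move=> sB; exists 1%R, 1; [apply: subgroup1|rewrite mulg1]. Qed.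

Lemma sub_cycle_mul x B : B `<=` cycle_mul x B.
Proof. by move=> b Bb; exists 0%R, b => //; rewrite mul1g. Qed.

Lemma cycle_mul_min x B H : is_subgroup H -> H x -> B `<=` H ->
  cycle_mul x B `<=` H.
Proof.
move=> sH Hx BH _ [k [b /BH Hb ->]].
by apply: subgroupM => //; apply: subgroup_expgz.
Qed.

Lemma normal_mul M N : normal_subgroup M -> normal_subgroup N ->
  normal_subgroup [set y | exists a b, [/\ M a, N b & y = a * b]].
Proof.
move=> nM nN; have sM := nM.1; have sN := nN.1; split; last first.
  move=> _ g [a [b [Ma Nb ->]]]; exists (a ^ g), (b ^ g); split.
  - exact: normalJ.
  - exact: normalJ.
  - by rewrite conjMg.
apply/is_subgroupP; split.
- by exists 1, 1; split; [apply: subgroup1|apply: subgroup1|rewrite mulg1].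
- move=> _ _ [a [b [Ma Nb ->]]] [c [d [Mc Nd ->]]].
  exists (a * c), (b ^ c * d); split.
  + exact: subgroupM.
  + by apply: subgroupM => //; apply: normalJ.
  + by group_id.
- move=> _ [a [b [Ma Nb ->]]]; exists a^-1, (b^-1 ^ a^-1); split.
  + exact: subgroupV.
  + by apply: normalJ => //; apply: subgroupV.
  + by group_id.
Qed.

(** In the abelian quotient G / K every subgroup is normal. *)
Lemma normal_of_derived K H : normal_subgroup K ->
  (forall x y, K [~ x, y]) -> is_subgroup H -> K `<=` H -> normal_subgroup H.
Proof.
move=> nK cK sH KH; split=> // x g Hx.
have -> : x ^ g = x * [~ x, g] by group_id.
by apply: subgroupM => //; apply: KH.
Qed.

End Subgroups.

(** * Polycyclic groups *)

(** The least positive element of [J] is a generator by Euclidean division; if there is none, [J] is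
    zero. *)
Lemma int_subgroup_principal (J : set int) : J 0%R ->
    (forall k l, J k -> J l -> J (k - l)%R) ->
  exists2 d, J d & forall k, J k -> exists q, k = (d * q)%R.
Proof.
move=> J0 JB.
have JN k : J k -> J (- k)%R by move=> Jk; rewrite -(sub0r k); apply: JB.
have JM d q : J d -> J (d * q)%R.
  move=> Jd; elim: q => [|n IH|n IH]; first by rewrite mulr0.
    have -> : (d * n.+1)%R = (d * n - - d)%R by lia.
    by apply: JB => //; apply: JN.
  have -> : (d * - n.+1%:Z)%R = (d * - n%:Z - d)%R by lia.
  exact: JB.
have [[n [n_gt0 Jn]]|noJ] := pselect (exists n : nat, (0 < n)%N /\ J n%:Z); last first.
  exists 0%R => // k Jk; exists 0%R; rewrite mulr0.
  apply: contrapT => k0; apply: noJ; exists `|k|%N; split; first by lia.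
  have [kge|klt] := leP 0%R k; first by have -> : `|k|%N = k :> int by lia.
  have -> : `|k|%N = (- k)%R :> int by lia.
  exact: JN.
have exP : exists n, (0 < n)%N && `[< J n%:Z >].
  by exists n; rewrite n_gt0; apply/asboolP.
case: (ex_minnP exP) => d /andP[d_gt0 /asboolP Jd] dmin.
exists d => // k Jk; exists (k %/ d)%Z.
have d0 : d%:Z != 0%R by lia.
have ge0 := modz_ge0 k d0; have lt := ltz_pmod k (_ : 0 < d%:Z)%R.
have {}lt := lt ltac:(lia).
have Er := divz_eq k d.
have Jr : J (k %% d)%Z.
  have -> : (k %% d)%Z = (k - d%:Z * (k %/ d)%Z)%R by lia.
  by apply: JB => //; apply: JM.
suff : (k %% d)%Z = 0%R by lia.
apply: contrapT => r0.
have := dmin `|(k %% d)%Z|%N.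
have -> : `[< J `|(k %% d)%Z|%N >].
  by apply/asboolP; have -> : `|(k %% d)%Z|%N = (k %% d)%Z :> int by lia.
by rewrite andbT => /(_ ltac:(lia)); lia.
Qed.

Section Polycyclic.
Variable G : groupType.
Implicit Types (x y g : G) (A B H K L M N P : set G).

(** The maximal condition, encoded as finite generation of every subgroup of [A]. *)
Definition noetherian A := forall H, is_subgroup H -> H `<=` A ->
  exists s : seq G, (forall y, y \in s -> H y) /\
    forall L, is_subgroup L -> (forall y, y \in s -> L y) -> H `<=` L.

Lemma cyclic_quotientP K N : is_normal N K -> cyclic_quotient K N ->
  exists2 x, K x & forall y, K y -> exists k, N ((expgz x k)^-1 * y).
Proof.
move=> [sN sK _ _] [x Kx xgen]; exists x => // y /xgen[k Ek]; exists k.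
have : left_coset y N y by exists 1; [apply: subgroup1|rewrite mulg1].
by rewrite Ek => -[u Nu <-]; rewrite mulKg.
Qed.

(** The exponents of the cosets of [N] met by [H] form a subgroup of Z with some generator d; an
    element of [H] over d, together with generators of the intersection of [H] and [N], generates
    [H]. *)
Lemma noetherian_extension K N : is_normal N K -> cyclic_quotient K N ->
  noetherian N -> noetherian K.
Proof.
move=> nNK cKN noeN H sH HK.
have [x Kx xgen] := cyclic_quotientP nNK cKN.
have [sN sK NK KnN] := nNK.
have nN k u : N u -> N (u ^ expgz x k).
  by apply: normalizerP; apply: KnN; apply: subgroup_expgz.
(* A relation rather than a function: the exponent of a coset is not unique when K / N is finite. *)
pose R (k : int) y := N ((expgz x k)^-1 * y).
have RM k l y z : R k y -> R l z -> R (k + l)%R (y * z).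
  move=> Ry Rz; rewrite /R expgzD.
  have -> : (expgz x k * expgz x l)^-1 * (y * z) =
    ((expgz x k)^-1 * y) ^ expgz x l * ((expgz x l)^-1 * z) by group_id.
  by apply: subgroupM => //; apply: nN.
have RV k y : R k y -> R (- k)%R y^-1.
  move=> Ry; rewrite /R.
  have -> : (expgz x (- k)%R)^-1 * y^-1 =
    (((expgz x k)^-1 * y)^-1) ^ expgz x (- k)%R by rewrite expgzN; group_id.
  by apply: nN; apply: subgroupV.
have R1 : R 0%R 1 by rewrite /R mulg1 invg1; apply: subgroup1.
have RX d h q : R d h -> R (d * q)%R (expgz h q).
  move=> Rh; elim: q => [|n IH|n IH]; first by rewrite mulr0.
    by rewrite -addn1 PoszD expgzS mulrDr mulr1; apply: RM.
  have -> : (- n.+1%:Z)%R = (- n%:Z + (- 1%:Z))%R by lia.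
  rewrite expgzD mulrDr mulrN1; apply: RM => //.
  by rewrite expgzN expgz1; apply: RV.
have [||d [h [Hh Rh]] dgen] :=
  @int_subgroup_principal [set k | exists h, H h /\ R k h].
- by exists 1; split=> //; apply: subgroup1.
- move=> k l [y [Hy Ry]] [z [Hz Rz]]; exists (y * z^-1); split.
    by apply: subgroupM => //; apply: subgroupV.
  by apply: RM => //; apply: RV.
have [s [sHN sgen]] := noeN _ (subgroupI sH sN) (@subIsetr _ H N).
exists (h :: s); split=> [y|L sL Ls y Hy].
  by rewrite inE => /orP[/eqP->//|/sHN[]].
have Lh : L h by apply: Ls; rewrite mem_head.
have [k Rk] := xgen _ (HK _ Hy).
have [q Ek] := dgen k (ex_intro _ y (conj Hy Rk)).
have Nz : N (y * (expgz h q)^-1).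
  have := RM _ _ _ _ Rk (RV _ _ (RX _ _ q Rh)).
  by rewrite Ek subrr /R invg1 mul1g.
rewrite -(mulgVK (expgz h q) y); apply: subgroupM => //; last exact: subgroup_expgz.
apply: (sgen L sL) => [z zs|]; first by apply: Ls; rewrite inE zs orbT.
by split=> //; apply: subgroupM => //; apply: subgroupV => //; apply: subgroup_expgz.
Qed.

Lemma polycyclic_noetherian : polycyclic G -> noetherian [set: G].
Proof.
move=> [n [A [A0 <- An]]].
suff : forall i, (i <= n)%N -> noetherian (A i) by apply.
elim=> [_|i IH ltin]; last first.
  by have [nA cA] := An i ltin; apply: noetherian_extension nA cA (IH (ltnW _)).
rewrite A0 => H sH H1; exists [::]; split=> // L sL _ x /H1 ->.
exact: subgroup1.
Qed.

(** Zorn's lemma applies: the union of a chain of subgroups is finitely generated, hence equal to a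
    member of the chain. *)
Lemma noetherian_max (F : set (set G)) H0 : noetherian [set: G] ->
  (forall H, F H -> is_subgroup H) -> F H0 ->
  exists2 H, F H & forall L, F L -> H `<=` L -> L `<=` H.
Proof.
move=> noe Fsub FH0.
(* The empty set is adjoined because the empty chain has empty union. *)
have [C CF totC|H [H_F Hmax]] := @Zorn_bigcup G [set H | F H \/ H = set0].
  have [[H1 [CH1 FH1]]|noF] := pselect (exists H, C H /\ F H); last first.
    right; apply/seteqP; split=> // x [X CX Xx].
    by case: (CF _ CX) => [FX|X0]; [case: noF; exists X|rewrite X0 in Xx].
  left; set U := \bigcup_(X in C) X.
  have sF X x : C X -> X x -> is_subgroup X.
    by move=> CX Xx; case: (CF _ CX) => [/Fsub//|X0]; rewrite X0 in Xx.
  have both X Y x y : C X -> C Y -> X x -> Y y -> exists2 Z, C Z & Z x /\ Z y.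
    move=> CX CY Xx Yy; case: (totC X Y CX CY) => [XY|YX].
      by exists Y => //; split=> //; apply: XY.
    by exists X => //; split=> //; apply: YX.
  have sU : is_subgroup U.
    apply/is_subgroupP; split.
    - by exists H1 => //; apply: subgroup1; apply: Fsub.
    - move=> x y [X CX Xx] [Y CY Yy]; have [Z CZ [Zx Zy]] := both _ _ _ _ CX CY Xx Yy.
      by exists Z => //; apply: subgroupM => //; apply: sF CZ Zx.
    - by move=> x [X CX Xx]; exists X => //; apply: subgroupV => //; apply: sF CX Xx.
  have [s [sUs sgen]] := noe U sU (@subsetT _ U).
  have [Z [CZ FZ] Zs] : exists2 Z, C Z /\ F Z & forall y, y \in s -> Z y.
    elim: s sUs {sgen} => [|y s IH] sUs; first by exists H1.
    have [|Z [CZ FZ] Zs] := IH; first by move=> z zs; apply: sUs; rewrite inE zs orbT.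
    have [Y CY Yy] : U y by apply: sUs; rewrite mem_head.
    case: (totC Z Y CZ CY) => [ZY|YZ].
      exists Y; last by move=> z; rewrite inE => /orP[/eqP->//|/Zs/ZY].
      by split=> //; case: (CF _ CY) => // Y0; rewrite Y0 in Yy.
    by exists Z => // z; rewrite inE => /orP[/eqP->|/Zs//]; apply: YZ.
  suff -> : U = Z by [].
  apply/seteqP; split; last by move=> z Zz; exists Z.
  by apply: sgen => //; apply: Fsub.
have FH : F H.
  case: H_F => // HE; case: (Hmax H0); last by left.
  rewrite HE; split=> // sub; exact: (sub 1 (subgroup1 (Fsub _ FH0))).
exists H => // L FL HL; apply: contrapT => nLH.
by case: (Hmax L); [split|left].
Qed.

(** Climbing the series, A_(i+1) is covered by the finitely many cosets x^j A_i with j < m, where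
    x^m = 1. *)
Lemma polycyclic_torsion_finite : polycyclic G ->
  (forall g, exists2 m, (0 < m)%N & g ^+ m = 1) -> finite_set [set: G].
Proof.
move=> [n [A [A0 <- An]]] tor.
suff : forall i, (i <= n)%N -> finite_set (A i) by apply.
elim=> [_|i IH ltin]; first by rewrite A0; apply: finite_set1.
have [nA cA] := An i ltin; have [x Kx xgen] := cyclic_quotientP nA cA.
have [m m_gt0 xm] := tor x.
apply: (@sub_finite_set _ _ [set x ^+ j * u | j in `I_m & u in A i]); last first.
  apply: finite_image2; first exact: finite_II.
  exact: IH (ltnW ltin).
move=> y /xgen[k Nk]; exists `|(k %% m)%Z|%N => /=.
  have := ltz_pmod k (_ : 0 < m%:Z)%R; have := modz_ge0 k (_ : m%:Z != 0%R).
  by move=> /(_ ltac:(lia)) ? /(_ ltac:(lia)) ?; lia.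
exists ((expgz x k)^-1 * y) => //.
suff -> : x ^+ `|(k %% m)%Z|%N = expgz x k by rewrite mulVKg.
have -> : x ^+ `|(k %% m)%Z| = expgz x (k %% m)%Z.
  by rewrite -[in RHS](gez0_abs (modz_ge0 k _))//; lia.
have Ek : k = (m%:Z * (k %/ m)%Z + (k %% m)%Z)%R by rewrite mulrC -divz_eq.
rewrite [in RHS]Ek (expgzD x (m%:Z * _)%R) (expgzM x m%:Z) /= xm.
suff -> : expgz (1 : G) (k %/ m)%Z = 1 by rewrite mul1g.
by case: (k %/ m)%Z => j /=; rewrite expg1n ?invg1.
Qed.

(** A subgroup containing [K] and [x] is everything. Applied to centralisers modulo [K], this makes
    [x] central modulo [K], and then every [z]. *)
Lemma derived_cyclic_quotient K x : normal_subgroup K ->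
  (forall y, exists k, K ((expgz x k)^-1 * y)) -> forall y z, K [~ y, z].
Proof.
move=> nK xgen; have sK := nK.1.
have full L : is_subgroup L -> K `<=` L -> L x -> forall y, L y.
  move=> sL KL Lx y; have [k /KL Lk] := xgen y.
  by rewrite -(mulVKg (expgz x k) y); apply: subgroupM => //; apply: subgroup_expgz.
have Kx y : K [~ x, y].
  apply: (full _ (subgroup_relcent1 x nK)) => [z Kz|] /=.
    exact: normalRr.
  by rewrite commgg; apply: subgroup1.
move=> y z; apply: commg_sym => //; move: y.
apply: (full _ (subgroup_relcent1 z nK)) => [y Ky|] /=; first exact: normalRr.
exact: commg_sym.
Qed.

(** The term just below the first occurrence of [G] in the series has a cyclic, hence abelian,
    quotient. *)
Lemma polycyclic_derived : polycyclic G -> [set: G] <> [set 1] ->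
  exists K, [/\ normal_subgroup K, K <> [set: G] & forall y z, K [~ y, z]].
Proof.
move=> [n [A [A0 AnT An]]] nt.
have exP : exists i, `[< A i = [set: G] >] by exists n; apply/asboolP.
case: (ex_minnP exP) => -[|i] /asboolP Ai imin; first by case: nt; rewrite -Ai A0.
have ltin : (i < n)%N by apply: imin; apply/asboolP.
have [nA cA] := An i ltin; have [x _ xgen] := cyclic_quotientP nA cA.
have nAi : normal_subgroup (A i).
  case: nA => sA _ _; rewrite Ai => nA; split=> // y g.
  by apply: normalizerP; apply: nA.
exists (A i); split=> //.
  by move=> /asboolT/imin; rewrite ltnn.
apply: (@derived_cyclic_quotient _ x nAi) => y.
by have [|k Nk] := xgen y; [rewrite Ai|exists k].
Qed.

End Polycyclic.

(** * Nilpotent subgroups *)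

Section Nilpotent.
Variable G : groupType.
Implicit Types (x y g h : G) (A B H K L M N P : set G).

Lemma lower_centralR H n y h :
  lower_central H n y -> H h -> lower_central H n.+1 [~ y, h].
Proof. by move=> Hy Hh K [_]; apply; exists y, h. Qed.

Lemma lower_central_subgroup H n : is_subgroup H -> is_subgroup (lower_central H n).
Proof. by case: n => [//|n] _; apply: smallest_subgroup. Qed.

Lemma lower_central_min H (P : nat -> set G) :
  (forall n, is_subgroup (P n)) -> H `<=` P 0%N ->
  (forall n y h, P n y -> H h -> P n.+1 [~ y, h]) ->
  forall n, lower_central H n `<=` P n.
Proof.
move=> sP HP0 PR; elim=> [//|n IH] z; apply; split=> //.
by move=> _ [y [h [/IH Py Hh ->]]]; apply: PR.
Qed.

Lemma lower_central_normal H n :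
  normal_subgroup H -> normal_subgroup (lower_central H n).
Proof.
move=> nH; have sH := nH.1; split; first exact: lower_central_subgroup.
(* The series is compared with its own preimages under conjugation by [g]. *)
move=> x g; apply: (@lower_central_min H (fun n => [set y | lower_central H n (y ^ g)])).
- by move=> k; apply: subgroup_preimJ; apply: lower_central_subgroup.
- by move=> y Hy; apply: normalJ.
- move=> k y h Hy Hh /=; rewrite conjRg.
  by apply: lower_centralR => //; apply: normalJ.
Qed.

Lemma nilpotent_intro H (P : nat -> set G) n : is_subgroup H ->
  (forall n, is_subgroup (P n)) -> H `<=` P 0%N ->
  (forall n y h, P n y -> H h -> P n.+1 [~ y, h]) ->
  P n `<=` [set 1] -> is_nilpotent H.
Proof.
move=> sH sP HP PR Pn; exists n; apply/seteqP; split.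
  by move=> z Hz; apply: Pn; apply: (lower_central_min sP HP PR) Hz.
by move=> _ ->; apply: subgroup1; apply: lower_central_subgroup.
Qed.

Lemma lower_central_stable H n m : is_subgroup H ->
  lower_central H n = [set 1] -> (n <= m)%N -> lower_central H m = [set 1].
Proof.
move=> sH Hn /subnK<-; elim: (m - n)%N => [//|k IH].
rewrite addSn; apply/seteqP; split.
  move=> z; apply; split; first exact: subgroup_set1.
  move=> _ [y [h [Hy Hh ->]]]; have -> : y = 1 by change ([set 1] y); rewrite -IH.
  by rewrite /= comm1g.
by move=> _ ->; apply: subgroup1; apply: lower_central_subgroup.
Qed.

(* Take [g] in the last term of the lower central series not inside [A]. *)
Lemma nilpotent_upper M A : is_subgroup M -> is_subgroup A -> is_nilpotent M ->
  ~ M `<=` A -> exists g, [/\ M g, ~ A g & forall h, M h -> A [~ g, h]].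
Proof.
move=> sM sA [n Mn] nMA.
have exP : exists i, `[< lower_central M i `<=` A >].
  by exists n; apply/asboolP; rewrite Mn => _ ->; apply: subgroup1.
case: (ex_minnP exP) => -[|i] /asboolP Ai imin; first by case: nMA.
have nAi : ~ lower_central M i `<=` A by move=> /asboolT/imin; rewrite ltnn.
have [g [Mg nAg]] : exists g, lower_central M i g /\ ~ A g.
  apply: contrapT => noex; apply: nAi => g Mg; apply: contrapT => nAg.
  by apply: noex; exists g.
exists g; split=> [|//|h Mh]; last by apply: Ai; apply: lower_centralR.
apply: (@lower_central_min M (fun=> M)) Mg => // _ y h My Mh.
exact: subgroupR.
Qed.

Let fitting_series M i := if i is j.+1 then lower_central M j else [set: G].

Let fitting_series_normal M i :
  normal_subgroup M -> normal_subgroup (fitting_series M i).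
Proof.
by case: i => [|i] nM; [split=> //; apply: subgroupT|apply: lower_central_normal].
Qed.

Let fitting_seriesR M i y h : normal_subgroup M ->
  fitting_series M i y -> M h -> fitting_series M i.+1 [~ y, h].
Proof.
by case: i => [|i] nM My Mh; [apply: normalRr|apply: lower_centralR].
Qed.

(* With F_0 = G and F_(i+1) = gamma_i, the subgroups generated by the
   F_i(M) :&: F_j(L) with i + j = n form a central series of G = M L. *)
Lemma fitting M L : normal_subgroup M -> normal_subgroup L ->
  is_nilpotent M -> is_nilpotent L ->
  (forall x, exists a b, [/\ M a, L b & x = a * b]) -> is_nilpotent [set: G].
Proof.
move=> nM nL [c Mc] [d Ld] ML.
have sM := nM.1; have sL := nL.1.
pose S n := [set z | exists i j,
  [/\ (i + j = n)%N, fitting_series M i z & fitting_series L j z]].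
pose P n := smallest (@is_subgroup G) (S n).
have sP n : is_subgroup (P n) by apply: smallest_subgroup.
have SP n : S n `<=` P n by move=> z Sz K [_]; apply.
have nP n : normal_subgroup (P n).
  split=> // x g Px; apply: (Px [set y | P n (y ^ g)]); split.
    exact: subgroup_preimJ.
  move=> z [i [j [ij Mz Lz]]]; apply: SP; exists i, j; split=> //.
    by apply: normalJ => //; apply: fitting_series_normal.
  by apply: normalJ => //; apply: fitting_series_normal.
apply: (@nilpotent_intro _ P (c + d).+1) => //.
- exact: subgroupT.
- by move=> x _; apply: SP; exists 0%N, 0%N.
- move=> n y g Py _.
  (* Being central modulo [P n.+1] is checked on the generators of [P n], and then against the two
     factors of [g] separately. *)
  suff : [set y | forall g, [set: G] g -> P n.+1 [~ y, g]] y by apply.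
  apply: Py; split; first exact: subgroup_relcent.
  move=> z [i [j [ij Mz Lz]]] {}g _.
  have [a [b [Ma Lb ->]]] := ML g.
  apply: (subgroupM (subgroup_relcent1 z (nP n.+1))); apply: SP.
    exists i.+1, j; split; rewrite -?ij//; first exact: fitting_seriesR.
    by apply: normalRl => //; apply: fitting_series_normal.
  exists i, j.+1; split; rewrite -?ij ?addnS//; last exact: fitting_seriesR.
  by apply: normalRl => //; apply: fitting_series_normal.
- move=> z; apply; split; first exact: subgroup_set1.
  move=> {}z [i [j [ij Mz Lz]]].
  (* As i + j = c + d + 1, either i > c or j > d; the shift by one in [fitting_series] makes that
     term trivial. *)
  have [ci|ic] := ltnP c i.
    by case: i ci {ij} Mz => //= i ci; rewrite (lower_central_stable sM Mc).
  have : (d < j)%N by lia.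
  by case: j {ij} Lz => //= j Lz dj; rewrite (lower_central_stable sL Ld) in Lz.
Qed.

Lemma lower_central_iterR H x y n : is_subgroup H -> H x -> H y ->
  lower_central H n (iter n (fun z => [~ z, x]) y).
Proof. by move=> sH Hx Hy; elim: n => //= n IH; apply: lower_centralR. Qed.

End Nilpotent.

(** * Abelian sections *)

Section UnipotentModP.
Variables (V : zmodType) (f : {additive V -> V}).

Let d v := (f v - v)%R.

Let fE v : f v = (d v + v)%R. Proof. by rewrite subrK. Qed.

(** The binomial theorem for f = 1 + d. *)
Lemma iter_additive_binomial n v :
  iter n f v = (\sum_(i < n.+1) iter i d v *+ 'C(n, i))%R.
Proof.
elim: n => [|n IH]; first by rewrite big_ord1.
rewrite iterS IH raddf_sum.
under eq_bigr do rewrite raddfMn fE -iterS mulrnDl.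
rewrite big_split /= [in RHS]big_ord_recl /= bin0 mulr1n.
under [in RHS]eq_bigr do rewrite binS mulrnDr.
rewrite big_split /= addrC addrA; congr (_ + _)%R.
by rewrite big_ord_recl [in RHS]big_ord_recr /= bin0 bin_small// mulr0n addr0.
Qed.

(** Expanding (1 + d)^p = 1 leaves d^p as minus the middle terms; each has a coefficient divisible
    by p and at least one factor d. *)
Lemma iter_sub_id_prime p v : prime p -> iter p f v = v ->
  exists w, iter p d v = (d w *+ p)%R.
Proof.
case: p => [//|p] p_pr; rewrite iter_additive_binomial.
rewrite big_ord_recl big_ord_recr /= bin0 binn !mulr1n.
rewrite -[RHS]addr0 => /addrI/eqP; rewrite addrC addr_eq0 => /eqP->.
(* The prime is now [p.+1]. The witness is the middle sum with one d and one factor [p.+1] removed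
   from each term. *)
exists (- \sum_(i < p) iter i d v *+ ('C(p.+1, i.+1) %/ p.+1))%R.
have dN u : d (- u)%R = (- d u)%R by rewrite /d raddfN opprD.
have dS (F : 'I_p -> V) : d (\sum_i F i)%R = (\sum_i d (F i))%R.
  by rewrite /d raddf_sum -sumrB.
have dM u k : d (u *+ k)%R = (d u *+ k)%R by rewrite /d raddfMn mulrnBl.
rewrite dN dS mulNrn -sumrMnl; congr (- _)%R.
apply: eq_bigr => i _; rewrite dM -mulrnA divnK //.
by apply: prime_dvd_bin => //=; rewrite ltnS ltn_ord.
Qed.

(** If w = d u and d w = 0, then f^k u = u + k w; taking k = p gives p w = 0, so w = 0. This lowers
    the nilpotency index of d down to 1. *)
Lemma torsionfree_unipotent p :
    (forall (v : V) k, (0 < k)%N -> (v *+ k = 0)%R -> v = 0%R) -> (0 < p)%N ->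
    (forall v, iter p f v = v) -> (exists n, forall v, iter n d v = 0%R) ->
  forall v, d v = 0%R.
Proof.
move=> tf p_gt0 fp [n]; elim: n => [v0 v|n IH dn]; first exact: v0.
case: n IH dn => [_ dn v|n IH dn]; first exact: dn.
apply: IH => v; set u := iter n d v; set w := iter n.+1 d v.
have dw : d w = 0%R by apply: dn.
have Ek k : iter k f u = (u + w *+ k)%R.
  elim: k => [|k IHk]; first by rewrite addr0.
  rewrite iterS IHk raddfD raddfMn !fE dw add0r -/(iter n.+1 d v) -/w mulrS.
  by rewrite -addrA [RHS]addrCA.
have := Ek p; rewrite fp -[X in X = _ -> _]addr0 => /addrI/esym.
exact: tf.
Qed.

End UnipotentModP.

(** * The quotient A / N as an additive group *)

Section AbelianSection.
Variables (G : groupType) (A N : set G).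
Hypotheses (sA : is_subgroup A) (nN : normal_subgroup N) (NA : N `<=` A).
Hypothesis (cA : forall a b, A a -> A b -> N [~ a, b]).

Let sN : is_subgroup N := nN.1.

Let cong a b := N (a^-1 * b).

(** The choice depends only on the coset of [a] as a set, so congruent elements get equal
    representatives. *)
Let rep a : G := xget 1 [set b | cong a b].

Let cong_refl a : cong a a.
Proof. by rewrite /cong mulVg; apply: subgroup1. Qed.

Let cong_sym a b : cong a b -> cong b a.
Proof. by move=> /(subgroupV sN); rewrite /cong invgM invgK. Qed.

Let cong_trans b a c : cong a b -> cong b c -> cong a c.
Proof.
by move=> ab bc; have := subgroupM sN ab bc; rewrite /cong -mulgA mulVKg.
Qed.

Let repP a : cong a (rep a).
Proof. exact: (@xgetPex _ 1 [set b | cong a b] (ex_intro _ a (cong_refl a))). Qed.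

Let rep_eq a b : cong a b -> rep a = rep b.
Proof.
move=> ab; rewrite /rep; congr xget; apply/seteqP; split=> c.
  exact: (cong_trans (cong_sym ab)).
exact: cong_trans.
Qed.

Let congM a b c d : cong a b -> cong c d -> cong (a * c) (b * d).
Proof.
move=> ab cd; rewrite /cong.
have -> : (a * c)^-1 * (b * d) = (a^-1 * b) ^ c * (c^-1 * d) by group_id.
by apply: subgroupM => //; apply: normalJ.
Qed.

Let cong_in a b : A a -> cong a b -> A b.
Proof. by move=> Aa /NA; apply: subgroupMl; last apply: subgroupV. Qed.

(** A / N is modelled by the canonical representatives lying in [A]. *)
Let carrier := {a : G | `[< A a /\ rep a = a >]}.

Let cls_subproof a (Aa : A a) : `[< A (rep a) /\ rep (rep a) = rep a >].
Proof.
apply/asboolP; split; first exact: cong_in (repP a).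
by apply/esym/rep_eq.
Qed.

Let one_subproof : A 1. Proof. exact: subgroup1. Qed.

(** Outside [A] the default value is the class of 1, which makes [cls] total on [G]. *)
Let cls a : carrier :=
  match pselect (A a) with
  | left Aa => exist _ (rep a) (cls_subproof Aa)
  | right _ => exist _ (rep 1) (cls_subproof one_subproof)
  end.

Let val_cls a : A a -> val (cls a) = rep a.
Proof. by rewrite /cls; case: pselect. Qed.

Let A_val (v : carrier) : A (val v).
Proof. by case: v => a /= /asboolP[]. Qed.

Let val_clsK (v : carrier) : cls (val v) = v.
Proof.
apply: val_inj; rewrite val_cls; last exact: A_val.
by case: v => a /= /asboolP[].
Qed.

Let cls_eq a b : A a -> A b -> cong a b -> cls a = cls b.
Proof.
by move=> Aa Ab ab; apply: val_inj; rewrite !val_cls//; apply: rep_eq.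
Qed.

Let cls_cong a : A a -> cong a (val (cls a)).
Proof. by move=> Aa; rewrite val_cls. Qed.

Let add (u v : carrier) := cls (val u * val v).

Let clsM a b : A a -> A b -> cls (a * b) = add (cls a) (cls b).
Proof.
move=> Aa Ab; apply: cls_eq; first exact: subgroupM.
  by apply: subgroupM => //; apply: A_val.
by apply: congM; apply: cls_cong.
Qed.

Let AM a b : A a -> A b -> A (a * b). Proof. exact: subgroupM. Qed.

Let addA : associative add.
Proof.
move=> u v w; rewrite -(val_clsK u) -(val_clsK v) -(val_clsK w).
by rewrite -!clsM ?mulgA//; do ?apply: AM; apply: A_val.
Qed.

Let addC : commutative add.
Proof.
move=> u v; rewrite /add; apply: cls_eq; do ?[apply: AM|exact: A_val].
rewrite /cong; have -> : (val u * val v)^-1 * (val v * val u) =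
  [~ val v, val u] by group_id.
by apply: cA; apply: A_val.
Qed.

Let add0 : left_id (cls 1) add.
Proof.
by move=> v; rewrite -{1}(val_clsK v) -clsM ?mul1g ?val_clsK//; apply: A_val.
Qed.

Let opp (v : carrier) := cls (val v)^-1.

Let addN : left_inverse (cls 1) opp add.
Proof.
move=> v; have AVv : A (val v)^-1 by apply: subgroupV => //; apply: A_val.
by rewrite -{2}(val_clsK v) -clsM ?mulVg//; apply: A_val.
Qed.

HB.instance Definition _ := Choice.on carrier.
HB.instance Definition _ := GRing.isZmodule.Build carrier addA addC add0 addN.

Lemma abelian_section_zmodule : exists (V : zmodType) (c : G -> V),
  [/\ forall a b, A a -> A b -> c (a * b) = (c a + c b)%R,
      forall a, A a -> (c a = 0%R <-> N a)
    & forall v, exists2 a, A a & c a = v].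
Proof.
exists carrier, cls; split=> [a b Aa Ab|a Aa|v]; first exact: clsM.
  have c1 : (0%R : carrier) = cls 1 by [].
  rewrite c1; split=> [/(congr1 val)|Na].
    rewrite !val_cls// => E.
    have := cong_trans (repP 1) _ (c := a); rewrite -E => /(_ (cong_sym (repP a))).
    by rewrite /cong invg1 mul1g.
  by apply: cls_eq => //; apply: cong_sym; rewrite /cong invg1 mul1g.
by exists (val v); [apply: A_val|apply: val_clsK].
Qed.

End AbelianSection.

(** * The class S *)

(** An integer q > 1 is not a unit. This turns an identity between an element and its q k-th
    multiple or power into a torsion relation. *)
Lemma absz_1Bmul_gt0 (q : nat) (k : int) :
  (1 < q)%N -> (0 < `|(1 - q%:Z * k)%R|)%N.
Proof.
move=> q_gt1; rewrite absz_gt0 subr_eq0; apply/eqP => /(congr1 absz).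
by rewrite abszM /= => /esym/eqP; rewrite muln_eq1 => /andP[/eqP q1 _]; lia.
Qed.

Section ClassS.
Variable G : groupType.
Implicit Types (x y g h : G) (A B H K L M N P : set G).

Lemma class_S_normalizer H a : class_S G -> is_subgroup H ->
  normalizer H a -> ~ H a -> is_nilpotent H.
Proof.
move=> cS sH nHa nH; apply: contrapT => nnil.
by rewrite (cS H sH nnil) in nHa.
Qed.

Lemma class_S_normal N : class_S G -> normal_subgroup N -> N <> [set: G] ->
  is_nilpotent N.
Proof.
move=> cS nN NT; have [a nNa] : exists a, ~ N a.
  by apply: contrapT => noa; apply: NT; apply/seteqP; split=> // a _;
     apply: contrapT => na; apply: noa; exists a.
exact: class_S_normalizer cS nN.1 (normal_normalizer a nN) nNa.
Qed.

(** Take [M] maximal. If M N were all of [G], then [G] would be a product of two nilpotent normal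
    subgroups, hence nilpotent by [fitting]. *)
Lemma class_S_max_normal : class_S G -> noetherian [set: G] ->
  ~ is_nilpotent [set: G] ->
  exists M, [/\ normal_subgroup M, M <> [set: G] &
    forall N, normal_subgroup N -> N <> [set: G] -> N `<=` M].
Proof.
move=> cS noe nnil.
have [||M [nM MT] Mmax] :=
  @noetherian_max G [set N | normal_subgroup N /\ N <> [set: G]] [set 1] noe.
- by move=> N [[]].
- split; last by move=> E; apply: nnil; exists 0%N.
  by split=> [|x g ->] /=; [apply: subgroup_set1|rewrite conj1g].
exists M; split=> // N nN NT; have nMN := normal_mul nM nN.
set MN := [set _ | _] in nMN; have sM := nM.1; have sN := nN.1.
have subM : M `<=` MN.
  by move=> a Ma; exists a, 1; split=> //; [apply: subgroup1|rewrite mulg1].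
have subN : N `<=` MN.
  by move=> b Nb; exists 1, b; split=> //; [apply: subgroup1|rewrite mul1g].
have [MNT|MNT] := pselect (MN = [set: G]); last first.
  by move=> b /subN; apply: Mmax.
case: nnil; apply: (fitting nM nN); try exact: class_S_normal.
by move=> x; have : MN x by rewrite MNT.
Qed.

(* Otherwise [<x^2> K] and [<x^3> K] are both proper, hence inside [M]. *)
Lemma class_S_derived M K x : is_subgroup M ->
    (forall N, normal_subgroup N -> N <> [set: G] -> N `<=` M) ->
    normal_subgroup K -> (forall y z, K [~ y, z]) -> ~ M x ->
  (forall y, cycle_mul x K y) /\ exists2 m, (0 < m)%N & K (x ^+ m).
Proof.
move=> sM Mmax nK cK nMx; have sK := nK.1.
have nC y : normal_subgroup (cycle_mul y K).
  apply: (normal_of_derived nK cK); last exact: sub_cycle_mul.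
  by apply: cycle_mul_subgroup => //; apply: normal_normalizer.
have full y : ~ M y -> cycle_mul y K = [set: G].
  by move=> nMy; apply: contrapT => /(Mmax _ (nC y)); apply: contra_not nMy;
     apply; apply: cycle_mul_id.
split=> [y|]; first by rewrite full.
have [q q_gt1 nMq] : exists2 q, (1 < q)%N & ~ M (x ^+ q).
  apply: contrapT => noq; apply: nMx.
  have M2 : M (x ^+ 2) by apply: contrapT => ?; apply: noq; exists 2%N.
  apply: (subgroupMl sM M2); rewrite -expgSr.
  by apply: contrapT => ?; apply: noq; exists 3%N.
have : cycle_mul (x ^+ q) K x by rewrite full.
move=> [k [b Kb xE]].
(* Since x = x^(q k) b, the power x^(1 - q k) is a conjugate of [b]. *)
have Kx : K (expgz x (1 - q%:Z * k)%R).
  suff -> : expgz x (1 - q%:Z * k)%R = b ^ (expgz x (q%:Z * k))^-1 by apply: normalJ.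
  by rewrite expgzD expgz1 {1}xE expgzN expgzM /=; group_id.
exists `|(1 - q%:Z * k)%R|%N; first exact: absz_1Bmul_gt0.
have [ge0|lt0] := leP 0%R (1 - q%:Z * k)%R.
  by rewrite -(gez0_abs ge0) in Kx.
move: Kx; rewrite -[X in expgz x X]opprK expgzN -(ltz0_abs lt0) /= => Kx.
by rewrite -[_ ^+ _]invgK; apply: subgroupV.
Qed.

Lemma expgM_mod N a b n : normal_subgroup N -> N b -> N (a ^- n * (a * b) ^+ n).
Proof.
move=> nN Nb; have sN := nN.1.
elim: n => [|n IH]; first by rewrite !expg0 invg1 mulg1; apply: subgroup1.
have -> : a ^- n.+1 * (a * b) ^+ n.+1 = (a ^- n * (a * b) ^+ n) ^ a * b.
  by rewrite !expgSr; group_id.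
by apply: subgroupM => //; apply: normalJ.
Qed.

(** [a^(n+1), h] = [a^n, h]^a [a, h], and modulo [N] conjugation by [a] fixes the powers of
    [a, h]. *)
Lemma commXg_mod N a h n : normal_subgroup N -> N [~ [~ a, h], a] ->
  N ([~ a ^+ n, h]^-1 * [~ a, h] ^+ n).
Proof.
move=> nN Nz; have sN := nN.1; set z := [~ a, h] in Nz *.
elim: n => [|n IH]; first by rewrite !expg0 comm1g mulg1 invg1; apply: subgroup1.
have -> : [~ a ^+ n.+1, h]^-1 * z ^+ n.+1 =
    (([~ a ^+ n, h]^-1 * z ^+ n) ^ a * [~ z ^+ n, a]^-1) ^ z.
  by rewrite !expgSr /z; group_id.
apply: normalJ => //; apply: subgroupM => //; first exact: normalJ.
apply: subgroupV => //.
have sC := @subgroup_relcent _ N [set a] nN.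
by have := subgroupX n sC (x := z); apply=> //= _ ->.
Qed.

(** The torsion elements of the abelian group A / N form a subgroup, and conjugation preserves
    exponents. It serves to prove A / N torsion-free. *)
Lemma torsion_mod_normal A N : normal_subgroup A -> normal_subgroup N ->
    N `<=` A -> (forall a b, A a -> A b -> N [~ a, b]) ->
  normal_subgroup [set a | A a /\ exists2 k, (0 < k)%N & N (a ^+ k)].
Proof.
move=> nA nN NA cA; have sA := nA.1; have sN := nN.1.
have [V [c [cM c0 _]]] := abelian_section_zmodule sA nN NA cA.
have cX a k : A a -> c (a ^+ k) = (c a *+ k)%R.
  move=> Aa; elim: k => [|k IH]; first by apply/(c0 1); apply: subgroup1.
  by rewrite expgS cM ?IH ?mulrS//; apply: subgroupX.
split; last first.
  move=> a g [Aa [k k_gt0 Nk]]; split; first exact: normalJ.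
  by exists k; rewrite // -conjXg; apply: normalJ.
apply/is_subgroupP; split.
- by split; [apply: subgroup1|exists 1%N => //; apply: subgroup1].
- move=> a b [Aa [k k_gt0 Nk]] [Ab [l l_gt0 Nl]]; split; first exact: subgroupM.
  exists (k * l)%N; first by rewrite muln_gt0 k_gt0.
  have Aab : A (a * b) by apply: subgroupM.
  apply/c0; first exact: subgroupX.
  have ck : (c a *+ k = 0)%R by rewrite -cX//; apply/c0 => //; apply: NA.
  have cl : (c b *+ l = 0)%R by rewrite -cX//; apply/c0 => //; apply: NA.
  by rewrite cX// cM// mulrnDl mulrnA ck mul0rn add0r mulnC mulrnA cl mul0rn.
- move=> a [Aa [k k_gt0 Nk]]; split; first exact: subgroupV.
  by exists k; rewrite // expVgn; apply: subgroupV.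
Qed.

(** On A / N the map d = f - 1 is commutation with [x], so the claim is d = 0; the two cases are [H]
    nilpotent and [H] self-normalising. *)
Lemma class_S_section_centralised A N x p : class_S G -> noetherian [set: G] ->
    normal_subgroup A -> normal_subgroup N -> N `<=` A ->
    (forall a b, A a -> A b -> N [~ a, b]) ->
    (forall a k, A a -> (0 < k)%N -> N (a ^+ k) -> N a) ->
    prime p -> (forall a, A a -> N [~ a, x ^+ p]) ->
  forall a, A a -> N [~ a, x].
Proof.
move=> cS noe nA nN NA cA tfA p_pr xp; have sA := nA.1; have sN := nN.1.
have [V [c [cM c0 c_surj]]] := abelian_section_zmodule sA nN NA cA.
have AJ a g : A a -> A (a ^ g) by apply: normalJ.
have AR a g : A a -> A [~ a, g] by apply: normalRl.
have cN a : N a -> c a = 0%R by move=> Na; apply/c0 => //; apply: NA.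
have c1 : c 1 = 0%R by apply: cN; apply: subgroup1.
have cV a : A a -> c a^-1 = (- c a)%R.
  move=> Aa; apply/eqP; rewrite -addr_eq0; apply/eqP.
  by rewrite -cM ?mulVg//; apply: subgroupV.
have cX a k : A a -> c (a ^+ k) = (c a *+ k)%R.
  move=> Aa; elim: k => [|k IH]; first exact: c1.
  by rewrite expgS cM ?IH ?mulrS//; apply: subgroupX.
have cJ a b g : A a -> A b -> c a = c b -> c (a ^ g) = c (b ^ g).
  move=> Aa Ab cab; apply/eqP; rewrite -subr_eq0; apply/eqP.
  have AbV : A b^-1 by apply: subgroupV.
  rewrite -cV -?cM -?conjVg -?conjMg//; do ?[by apply: AJ]; apply: cN.
  apply: normalJ => //; apply/c0; first exact: subgroupM.
  by rewrite cM// cV// cab subrr.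
(* A section of [c] transports conjugation by [x] to [V]; [cJ] shows that the result depends only on
   classes. *)
have [r rP] : exists r : V -> G, forall v, A (r v) /\ c (r v) = v.
  have := @choice V G (fun v a => A a /\ c a = v).
  by case=> [v|r rP]; [have [a] := c_surj v; exists a|exists r].
pose f v := c (r v ^ x).
have fc a : A a -> f (c a) = c (a ^ x).
  by move=> Aa; have [Ar cr] := rP (c a); apply: cJ.
have fB : GRing.zmod_morphism f.
  move=> u v; have [Au <-] := rP u; have [Av <-] := rP v.
  have AvV := subgroupV sA Av.
  rewrite -cV// -cM// fc; last exact: subgroupM.
  rewrite conjMg cM; [|exact: AJ|exact: AJ].
  by rewrite conjVg cV ?fc//; apply: AJ.
pose fA : {additive V -> V} := HB.pack f (GRing.isZmodMorphism.Build V V f fB).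
pose d v := (fA v - v)%R.
have dc a : A a -> d (c a) = c [~ a, x].
  move=> Aa; rewrite commgEl (cM a^-1); [|exact: subgroupV|exact: AJ].
  by rewrite cV// addrC /d /= fc.
have dD u v : d (u + v)%R = (d u + d v)%R.
  by rewrite /d raddfD opprD addrACA.
have fp v : iter p fA v = v.
  have [a Aa <-] := c_surj v.
  have E n : iter n fA (c a) = c (a ^ (x ^+ n)).
    elim: n => [|n IH]; first by rewrite conjg1.
    by rewrite iterS IH expgSr conjgM /= fc//; apply: AJ.
  rewrite E; have -> : a ^ (x ^+ p) = a * [~ a, x ^+ p] by group_id.
  by rewrite cM ?[X in (_ + X)%R]cN ?addr0//; [apply: xp|apply: AR].
have tf (v : V) k : (0 < k)%N -> (v *+ k = 0 -> v = 0)%R.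
  have [a Aa <-] := c_surj v; rewrite -cX// => k_gt0 ak0.
  by apply: cN; apply: (tfA a k) => //; apply/c0 => //; apply: subgroupX.
suff d0 v : d v = 0%R.
  by move=> a Aa; apply/c0; [apply: AR|rewrite -dc].
(* The preimage in [A] of the image of d. *)
pose A1 : set G := [set a | A a /\ exists2 b, A b & c a = c [~ b, x]].
have sA1 : is_subgroup A1.
  apply/is_subgroupP; split.
  - by split; [apply: subgroup1|exists 1; [apply: subgroup1|rewrite comm1g]].
  - move=> a1 a2 [Aa1 [b1 Ab1 E1]] [Aa2 [b2 Ab2 E2]]; split; first exact: subgroupM.
    have Ab := subgroupM sA Ab1 Ab2.
    by exists (b1 * b2) => //; rewrite cM// E1 E2 -!dc// -dD cM.
  - move=> a1 [Aa1 [b1 Ab1 E1]]; split; first exact: subgroupV.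
    have AbV := subgroupV sA Ab1.
    by exists b1^-1 => //; rewrite cV// E1 -!dc// cV// /d raddfN opprD.
(* An element commuting with [x] acts on A / N by a map commuting with d, so it preserves the image
   of d; this is used for [x] and its inverse. *)
have A1x a g : [~ g, x] = 1 -> A1 a -> A1 (a ^ g).
  move=> /eqP gx [Aa [b Ab E]]; split; first exact: AJ.
  exists (b ^ g); first exact: AJ.
  rewrite (cJ _ _ _ Aa (AR _ _ Ab) E) conjRg; congr (c [~ _, _]).
  by apply/conjg_fixP; rewrite commg1_sym.
have nA1 : normalizer A1 x.
  apply: normalizer_intro => // y; apply: A1x; first by rewrite commgg.
  by rewrite -invgR commgVg invg1.
have NA1 : N `<=` A1.
  move=> b Nb; split; first exact: NA.
  by exists 1; [apply: subgroup1|rewrite comm1g c1 cN].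
have RA1 a : A a -> A1 [~ a, x] by split; [apply: AR|exists a].
pose H := cycle_mul x A1.
have sH : is_subgroup H by apply: cycle_mul_subgroup.
have A1H : A1 `<=` H by apply: sub_cycle_mul.
have Hx : H x by apply: cycle_mul_id.
(* Conjugation by [b] changes [x] by a commutator in [A1], and changes elements of [A1] only by
   elements of [N]. *)
have HJ b : A b -> forall y, H y -> H (y ^ b).
  move=> Ab; apply: cycle_mul_min => /=; first exact: subgroup_preimJ.
    have -> : x ^ b = x * [~ b, x]^-1 by group_id.
    by apply: subgroupM => //; apply: A1H; apply: subgroupV => //; apply: RA1.
  move=> a A1a /=; have -> : a ^ b = a * [~ a, b] by group_id.
  apply: subgroupM => //; apply: A1H => //; apply: NA1.
  by apply: cA => //; case: A1a.
(* Iterated commutators with [x] descend the lower central series of [H]; the extra d in [n.+1]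
   first brings [v] into the image of [A1]. *)
have [[n Hn]|nnil] := pselect (is_nilpotent H).
  apply: (torsionfree_unipotent tf (prime_gt0 p_pr) fp); exists n.+1 => {}v.
  rewrite iterSr; have [a Aa <-] := c_surj v; rewrite -/(d _) dc//.
  have E m b : A b -> iter m d (c b) = c (iter m (fun z => [~ z, x]) b).
    move=> Ab; elim: m => //= m ->; rewrite dc//.
    by elim: m => //= m; apply: AR.
  rewrite E; last exact: AR.
  have := lower_central_iterR n sH Hx (A1H _ (RA1 _ Aa)).
  by rewrite Hn => ->.
have AH : A `<=` H.
  move=> a Aa; have <- := cS H sH nnil; apply: normalizer_intro => //; apply: HJ => //.
  exact: subgroupV.
(* Write a = x^k b with [b] in [A1]: then x^k lies in [A] and commutes with [x], so d kills it and
   only the class of [b], already a value of d, contributes. *)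
have dd v' : exists u, d v' = d (d u).
  have [a Aa <-] := c_surj v'; have [k [b [Ab [b' Ab' bE]] aE]] := AH a Aa.
  exists (c b'); have Axk : A (expgz x k) by apply: (subgroupMr sA Ab); rewrite -aE.
  have dxk : d (c (expgz x k)) = 0%R.
    rewrite dc// (_ : [~ expgz x k, x] = 1) ?c1//; apply/eqP.
    by rewrite commg1_sym; case: (k) => m; rewrite ?commgXg ?commgXVg.
  by rewrite aE cM// dD dxk add0r bE -(dc b').
have dj j v' : exists u, d v' = iter j d (d u).
  elim: j v' => [|j IH] v'; first by exists v'.
  have [u ->] := IH v'; have [w ->] := dd u.
  by exists w; rewrite -iterSr.
have dp v' : exists w, d v' = (d w *+ p)%R.
  have [u ->] := dj p v'; have [w] := iter_sub_id_prime p_pr (fp (d u)).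
  by exists w.
apply: contrapT => dv.
(* The preimage of the cyclic group generated by d w. If [L w] is maximal and d w = p d u, then d u
   is a multiple of d w, so (1 - p k) d u = 0 for some k, against torsion-freeness. *)
pose L w : set G := [set a | A a /\ exists k, c a = (d w *~ k)%R].
have [||_ [w [dw ->]] Lmax] :=
  @noetherian_max G [set B | exists w, d w <> 0%R /\ B = L w] (L v) noe.
- move=> _ [w [_ ->]]; apply/is_subgroupP; split.
  + by split; [apply: subgroup1|exists 0%R; rewrite c1].
  + move=> a b [Aa [k Ea]] [Ab [l El]]; split; first exact: subgroupM.
    by exists (k + l)%R; rewrite cM// Ea El mulrzDr.
  + move=> a [Aa [k Ea]]; split; first exact: subgroupV.
    by exists (- k)%R; rewrite cV// Ea mulrNz.
- by exists v.
have [u uE] := dp w.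
have du : d u <> 0%R by move=> du; apply: dw; rewrite uE du mul0rn.
have [a Aa aE] := c_surj (d u).
have [|||_ [k kE]] := Lmax (L u) _ _ a.
- by exists u.
- move=> b [Ab [k kE]]; split=> //; exists (p%:Z * k)%R.
  by rewrite kE uE mulrzA.
- by split=> //; exists 1%R.
apply: du; rewrite -aE; move: kE; rewrite uE -aE => kE.
have {kE} : (c a *~ (1 - p%:Z * k) = 0)%R.
  by rewrite mulrzBr mulrzA -kE subrr.
have := absz_1Bmul_gt0 k (prime_gt1 p_pr).
have [ge0|lt0] := leP 0%R (1 - p%:Z * k)%R.
  by rewrite -{2}(gez0_abs ge0) => pk; apply: tf.
rewrite -[X in (_ *~ X)%R]opprK -(ltz0_abs lt0) mulrNz => pk /eqP.
by rewrite oppr_eq0 => /eqP; apply: tf.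
Qed.

End ClassS.

(** * The contradiction for a non-nilpotent infinite polycyclic group in the class *)

Theorem proposition3p8 (G : groupType)
    (G_infinite : infinite_set [set: G]%classic)
    (G_polycyclic : polycyclic G)
    (G_in_S : class_S G) :
  is_nilpotent [set: G]%classic.
Proof.
apply: contrapT => nnil.
have noe := polycyclic_noetherian G_polycyclic.
have [M [nM MT Mmax]] := class_S_max_normal G_in_S noe nnil.
have sM := nM.1.
have nilM : is_nilpotent M by apply: class_S_normal.
have [|K [nK KT cK]] := polycyclic_derived G_polycyclic.
  by move=> GT; apply: nnil; exists 0%N.
have KM := Mmax K nK KT.
have [x0 nMx0] : exists x, ~ M x.
  apply: contrapT => nox; apply: MT; apply/seteqP; split=> // x _.
  by apply: contrapT => nMx; apply: nox; exists x.
have [_ [m0 m0_gt0 Kx0]] := class_S_derived sM Mmax nK cK nMx0.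
(* With n the order of [x0] modulo [M] and p a prime divisor of n, take x = x0^(n/p). *)
have [x nMx [p p_pr Mxp]] : exists2 x, ~ M x & exists2 p, prime p & M (x ^+ p).
  have exP : exists n, (0 < n)%N && `[< M (x0 ^+ n) >].
    by exists m0; rewrite m0_gt0; apply/asboolP/KM.
  case: (ex_minnP exP) => n /andP[n_gt0 /asboolP Mn] nmin.
  have n_gt1 : (1 < n)%N.
    by case: n n_gt0 Mn {nmin} => [//|[|//]] _; rewrite expg1.
  have p_pr := pdiv_prime n_gt1; have p_gt1 := prime_gt1 p_pr.
  have nE := divnK (pdiv_dvd n).
  exists (x0 ^+ (n %/ pdiv n)); last first.
    by exists (pdiv n) => //; rewrite -expgnA nE.
  move=> /asboolT Mj; have := nmin (n %/ pdiv n)%N; rewrite Mj andbT.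
  have : (0 < n %/ pdiv n)%N by rewrite divn_gt0 ?pdiv_gt0// dvdn_leq// pdiv_dvd.
  by move=> j_gt0 /(_ j_gt0); rewrite leqNgt ltn_Pdiv.
(* [M] and [x] generate [G], because G = <x> K and K <= M. *)
have genG (L : set G) : is_subgroup L -> M `<=` L -> L x -> forall y, L y.
  move=> sL ML Lx y; have [+ _] := class_S_derived sM Mmax nK cK nMx.
  by move=> /(_ y); apply: cycle_mul_min => // z /KM/ML.
have perM y : exists2 k, (0 < k)%N & M (y ^+ k).
  have [My|nMy] := pselect (M y); first by exists 1%N.
  have [_ [k k_gt0 /KM]] := class_S_derived sM Mmax nK cK nMy.
  by exists k.
have [g0 g0_inf] : exists g : G, forall k, (0 < k)%N -> g ^+ k <> 1.
  apply: contrapT => nog; apply: G_infinite.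
  apply: polycyclic_torsion_finite => // g; apply: contrapT => gk.
  by apply: nog; exists g => k k_gt0 gk1; apply: gk; exists k.
have [||N [nN [g gN]] Nmax] := @noetherian_max G
  [set N | normal_subgroup N /\ exists g, forall k, (0 < k)%N -> ~ N (g ^+ k)]
  [set 1] noe.
- by move=> N [[]].
- split; last by exists g0.
  by split=> [|y h ->] /=; [apply: subgroup_set1|rewrite conj1g].
have sN := nN.1.
(* Maximality of [N] makes the quotient by any strictly larger normal subgroup periodic. *)
have perN L : normal_subgroup L -> N `<=` L -> ~ L `<=` N ->
    forall y, exists2 k, (0 < k)%N & L (y ^+ k).
  move=> nL NL nLN y; apply: contrapT => yk; apply: nLN.
  apply: Nmax => //; split=> //; exists y => k k_gt0 Lk.
  by apply: yk; exists k.
have NT : N <> [set: G] by move=> NE; apply: (gN 1%N) => //; rewrite NE.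
have NM := Mmax N nN NT.
have nMN : ~ M `<=` N by move=> MN; have [k k_gt0 /MN/gN] := perM g; apply.
pose A := [set a | M a /\ forall h, M h -> N [~ a, h]].
have AM : A `<=` M by move=> a [].
have NA : N `<=` A.
  by move=> a Na; split=> [|h _]; [apply: NM|apply: normalRl].
have nA : normal_subgroup A.
  split; first exact: subgroupI sM (subgroup_relcent M nN).
  move=> a y [Ma Na]; split=> [|h Mh]; first exact: normalJ.
  rewrite -(conjgKV y h) -conjRg; apply: normalJ => //; apply: Na.
  exact: normalJ.
have sA := nA.1.
have cA a b : A a -> A b -> N [~ a, b] by move=> [_ Na] /AM/Na.
(* M / N is nilpotent and nontrivial, so its centre is nontrivial. *)
have nAN : ~ A `<=` N.
  have [a [Ma nNa Na]] := nilpotent_upper sM sN nilM nMN.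
  by move=> AN; apply: nNa; apply: AN.
have perA := perN A nA NA nAN.
(* If the torsion part T / N were nontrivial, G / T would be periodic, and a positive power of [g]
   would lie in [N]. *)
have tfA a k : A a -> (0 < k)%N -> N (a ^+ k) -> N a.
  move=> Aa k_gt0 Nk; have nT := torsion_mod_normal nA nN NA cA.
  set T := [set _ | _] in nT.
  suff TN : T `<=` N by apply: TN; split=> //; exists k.
  apply: contrapT => nTN; have [|j j_gt0 [_ [l l_gt0]]] := perN T nT _ nTN g.
    by move=> b Nb; split; [apply: NA|exists 1%N].
  by rewrite -expgnA; apply: gN; rewrite muln_gt0 j_gt0.
have Ax : forall a, A a -> N [~ a, x].
  apply: (class_S_section_centralised G_in_S noe nA nN NA cA tfA p_pr).
  by move=> a [_]; apply.
have zA a y : A a -> N [~ a, y].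
  move=> Aa; apply: (genG _ (subgroup_relcent1 a nN)) => [h Mh|] /=.
    by case: Aa => _; apply.
  exact: Ax.
(* Otherwise some [a] in [M] outside [A] is central in [M] modulo [A]. Modulo [N], [a, h]^k =
   [a^k, h], which is trivial once a^k is in [A]; hence [a, h] is in [N]. *)
have MA : M `<=` A.
  apply: contrapT => nMA; have [a [Ma nAa Aa]] := nilpotent_upper sM sA nilM nMA.
  apply: nAa; split=> // h Mh; have Az := Aa h Mh.
  have [k k_gt0 Ak] := perA a.
  apply: (tfA _ k) => //.
  apply: (subgroupMl sN (subgroupV sN (zA _ h Ak))).
  by apply: commXg_mod => //; apply: zA.
have cN y z : N [~ y, z].
  have Nx w : N [~ x, w].
    apply: (genG _ (subgroup_relcent1 x nN)) => [h /MA Ah|] /=.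
      by apply: commg_sym => //; apply: zA.
    by rewrite commgg; apply: subgroup1.
  have := genG _ (@subgroup_relcent _ N [set: G] nN) _ _ y z; apply=> //.
  by move=> h /MA Ah w _; apply: zA.
(* Now G = <x> N with x^m in [N], so g^m is congruent to x^(k m), hence in [N], against the choice
   of [g]. *)
have [gen [m m_gt0 Nxm]] := class_S_derived sM Mmax nN cN nMx.
have [k [b Nb gE]] := gen g.
apply: (gN m m_gt0); have := expgM_mod (expgz x k) m nN Nb; rewrite -gE.
apply: subgroupMl => //; apply: subgroupV => //.
have -> : expgz x k ^+ m = expgz (x ^+ m) k.
  by rewrite -[LHS]/(expgz (expgz x k) m) -expgzM mulrC expgzM.
exact: subgroup_expgz.
Qed.
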